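(* Consider the contextual bilateral trade problem in the one-bit feedback model. There exists an efficiency-maximizing algorithm that achieves regret $O(d \log d)$ and whose negative profit $\sum_{t=1}^T \max\{0,-\mathrm{Profit}_t(p_t,q_t)\}$ is at most $O(d \log d)$.
   Context: Contextual bilateral trade: Let $\mathbb{B}=\{w\in\mathbb{R}^d:\|w\|_2\le 1\}$. There are two fixed vectors $s,b\in\mathbb{B}$ unknown to the learner. At each time $t=1,\dots,T$, the learner observes a context $x_t\in\mathbb{B}$ (the contexts and $s,b$ are fixed in advance by an oblivious adversary; this is an instance), and posts a price $p_t$ to the seller and $q_t$ to the buyer (possibly $p_t>q_t$). Valuations: $s_t=\langle s,x_t\rangle$, $b_t=\langle b,x_t\rangle$; the trade happens iff $s_t\le p_t$ and $q_t\le b_t$. Gain from trade: $\mathrm{GFT}_t(p_t,q_t)=(b_t-s_t)\,\mathbb{1}\{s_t\le p_t\}\mathbb{1}\{q_t\le b_t\}$; profit: $\mathrm{Profit}_t(p_t,q_t)=(q_t-p_t)\,\mathbb{1}\{s_t\le p_t\}\mathbb{1}\{q_t\le b_t\}$. One-bit feedback: after each round the learner observes only $\mathbb{1}\{s_t\le p_t\}\cdot\mathbb{1}\{q_t\le b_t\}$. Regret of a (possibly randomized) algorithm $\mathcal{A}$: $R_T(\mathcal{A})=\sup_{\mathcal{I}}\mathbb{E}\big[\sum_{t=1}^T (b_t-s_t)_+-\sum_{t=1}^T\mathrm{GFT}_t(p_t,q_t)\big]$. The $O(\cdot)$ hides absolute constants independent of $d$ and $T$. *)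

(* Defs.v *)
From HB Require Import structures.
From mathcomp Require Import all_boot all_order all_algebra.
From mathcomp Require Import all_classical all_reals exp.
Set Implicit Arguments. Unset Strict Implicit. Unset Printing Implicit Defensive.
Import Order.TTheory GRing.Theory Num.Theory.
Local Open Scope ring_scope.

Section Bilateral.
Variables (R : realType) (d : nat).

Definition dotp (u v : 'rV[R]_d) : R := \sum_(i < d) u 0 i * v 0 i.

Definition inBall (w : 'rV[R]_d) : Prop := dotp w w <= 1.

(* A deterministic learner with one-bit feedback: at round t (0-based) it
   sees the contexts x_0..x_t and the feedback bits of rounds 0..t-1 and
   posts (p_t, q_t) = (seller price, buyer price). *)
Definition policy := seq 'rV[R]_d -> seq bool -> R * R.

Definition valid_instance (T : nat) (s b : 'rV[R]_d) (x : nat -> 'rV[R]_d) :=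
  [/\ inBall s, inBall b & forall t, (t < T)%N -> inBall (x t)].

Definition ctx_prefix (x : nat -> 'rV[R]_d) (n : nat) : seq 'rV[R]_d :=
  mkseq x n.

Fixpoint history (pol : policy) (s b : 'rV[R]_d) (x : nat -> 'rV[R]_d)
    (t : nat) : seq bool :=
  match t with
  | 0%N => [::]
  | t'.+1 =>
      let h := history pol s b x t' in
      let pq := pol (ctx_prefix x t'.+1) h in
      rcons h ((dotp s (x t') <= pq.1) && (pq.2 <= dotp b (x t')))
  end.

Definition prices (pol : policy) (s b : 'rV[R]_d) (x : nat -> 'rV[R]_d) (t : nat) : R * R :=
  pol (ctx_prefix x t.+1) (history pol s b x t).

Definition trade (pol : policy) (s b : 'rV[R]_d) (x : nat -> 'rV[R]_d) (t : nat) : bool :=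
  let pq := prices pol s b x t in
  (dotp s (x t) <= pq.1) && (pq.2 <= dotp b (x t)).

Definition gft (pol : policy) (s b : 'rV[R]_d) (x : nat -> 'rV[R]_d) (t : nat) : R :=
  (dotp b (x t) - dotp s (x t)) * (trade pol s b x t)%:R.

Definition profit (pol : policy) (s b : 'rV[R]_d) (x : nat -> 'rV[R]_d) (t : nat) : R :=
  let pq := prices pol s b x t in (pq.2 - pq.1) * (trade pol s b x t)%:R.

Definition det_regret (pol : policy) (T : nat) (s b : 'rV[R]_d) (x : nat -> 'rV[R]_d) : R :=
  \sum_(t < T) (Num.max (dotp b (x t) - dotp s (x t)) 0 - gft pol s b x t).

Definition neg_profit (pol : policy) (T : nat) (s b : 'rV[R]_d) (x : nat -> 'rV[R]_d) : R :=
  \sum_(t < T) Num.max 0 (- profit pol s b x t).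

(* A randomized algorithm: a finitely supported probability distribution
   over deterministic policies (its internal randomness). *)
Definition rand_alg := seq (R * policy).

Definition is_distribution (A : rand_alg) : Prop :=
  (forall wp, wp \in A -> 0 <= wp.1) /\ \sum_(wp <- A) wp.1 = 1.

Definition exp_regret (A : rand_alg) (T : nat) (s b : 'rV[R]_d) (x : nat -> 'rV[R]_d) : R :=
  \sum_(wp <- A) wp.1 * det_regret wp.2 T s b x.

End Bilateral.

(* Main.v *)
Require Import Defs.
From mathcomp Require Import all_boot all_order all_algebra.
From mathcomp Require Import all_classical all_reals exp.
From mathcomp Require Import ring lra.
Set Implicit Arguments. Unset Strict Implicit. Unset Printing Implicit Defensive.
Import Order.TTheory GRing.Theory Num.Theory.
Local Open Scope ring_scope.

(* The learner is deterministic. It keeps the convex sets [S] and [B] of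
   seller and buyer vectors consistent with the past. If the ranges of the two
   valuations are ordered, safe prices give no loss. Otherwise both losses are
   at most twice the larger width, and by pricing the other side safely the
   feedback bit cuts the wider set along a hyperplane chosen by the learner.

   The cut is balanced for a volume-like potential at a scale polynomially (in
   [d]) smaller than the width [w]: a weighted sum of packing numbers of the
   set over a geometric sequence of radii. The potential is superadditive
   across a small gap, and shrinks by at most a constant factor under a
   homothety of ratio [1 - 1/(4(d+1))] towards a point of the set; the latter
   moves a hyperplane across the gap. Hence some cut leaves at most 3/4 of the
   potential on either side. The logarithm of the potential at scale [2^-i] is
   [O(d log d + d i)], which bounds the number of cuts at this scale, and
   summing [2^-i (d log d + d i)] over [i] gives [O(d log d)]. *)

(** * Packing numbers and the potential *)

Lemma bernoulli_ineq (R : realDomainType) (x : R) (n : nat) :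
  0 <= x <= 1 -> 1 - n%:R * x <= (1 - x) ^+ n.
Proof.
move=> /andP[x0 x1]; elim: n => [|n IH]; first by rewrite mul0r subr0 expr0.
rewrite exprS; apply: le_trans (ler_wpM2l _ IH); last by lra.
have := ler0n R n; rewrite -natr1; set m := n%:R => m0.
have : 0 <= m * x * x by rewrite !mulr_ge0.
by lra.
Qed.

(** Bernoulli's inequality for the inverse power: it gives the decay of [(1 - x) ^+ n] in [n] that
    makes the truncated tail of the potential small. *)
Lemma expr_1subM_le1 (R : realDomainType) (x : R) (n : nat) :
  0 <= x <= 1 -> (1 - x) ^+ n * (1 + n%:R * x) <= 1.
Proof.
move=> /andP[x0 x1]; elim: n => [|n IH]; first by rewrite mul0r addr0 mulr1.
apply: le_trans IH; rewrite exprSr -mulrA ler_wpM2l ?exprn_ge0 ?subr_ge0//.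
have := ler0n R n; rewrite -natr1; set m := n%:R => m0.
have : 0 <= m * x * x by rewrite !mulr_ge0.
have : 0 <= x * x by rewrite mulr_ge0.
by lra.
Qed.

Section Packing.
Variables (R : realType) (d : nat).
Local Notation V := 'rV[R]_d.
Implicit Types (S : pred V) (u v x : V) (z : R).

Lemma dotpDl u v x : dotp (u + v) x = dotp u x + dotp v x.
Proof.
by rewrite /dotp -big_split; apply: eq_bigr => i _; rewrite mxE mulrDl.
Qed.

Lemma dotpZl (a : R) u x : dotp (a *: u) x = a * dotp u x.
Proof. by rewrite /dotp mulr_sumr; apply: eq_bigr => i _; rewrite mxE mulrA. Qed.

Lemma dotpBl u v x : dotp (u - v) x = dotp u x - dotp v x.
Proof. by rewrite -scaleN1r dotpDl dotpZl mulN1r. Qed.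

Lemma dotpC u v : dotp u v = dotp v u.
Proof. by apply: eq_bigr => i _; rewrite mulrC. Qed.

Lemma inBall_coord u : inBall u -> forall k, `|u 0 k| <= 1.
Proof.
rewrite /inBall /dotp => h k.
have : u 0 k * u 0 k <= 1.
  apply: le_trans h; rewrite (bigD1 k)//= lerDl.
  by apply: sumr_ge0 => i _; rewrite -expr2 sqr_ge0.
by rewrite -expr2 -real_normK ?num_real// expr_le1.
Qed.

Lemma ler_norm_dotp u x (c : R) : inBall x -> (forall k, `|u 0 k| <= c) ->
  `|dotp u x| <= d%:R * c.
Proof.
move=> xB uc; rewrite /dotp; apply: le_trans (ler_norm_sum _ _ _) _.
rewrite mulr_natl -[X in c *+ X]card_ord -sumr_const; apply: ler_sum => k _.
rewrite normrM; apply: le_trans (uc k).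
by rewrite ler_piMr// inBall_coord.
Qed.

Definition sep z u v := [exists k, z <= `|u 0 k - v 0 k|].

Definition is_packing S z (l : seq V) := all S l && pairwise (sep z) l.

Definition ncell z : nat := (Num.truncn (2 / z)).+1.

(** The range of the maximum is a grid count; by [packing_size] no packing of a subset of the cube
    exceeds it. *)
Definition packing_number S z : nat :=
  \max_(n < (ncell z ^ d).+1 | `[< exists2 l, is_packing S z l & size l = n >]) n.

Definition in_cube S := forall v, S v -> forall k, `|v 0 k| <= 1.

(** Pigeonhole: two points in the same grid cell of side [z] differ by less than [z] in every
    coordinate. *)
Lemma packing_size S z l : 0 < z -> in_cube S -> is_packing S z l ->
  (size l <= ncell z ^ d)%N.
Proof.
move=> z0 Sc /andP[lS lz].
pose f v : {ffun 'I_d -> 'I_(ncell z)} :=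
  [ffun k => inord (Num.truncn ((v 0 k + 1) / z))].
have fu : uniq (map f l).
  rewrite uniq_pairwise pairwise_map; apply: sub_in_pairwise lS lz => u v uS vS.
  move=> /existsP[k]; rewrite leNgt /=; apply: contraNN => /eqP fuv.
  have b w : w \in S -> 0 <= (w 0 k + 1) / z <= 2 / z.
    move=> /Sc/(_ k); rewrite ler_norml => /andP[? ?].
    by rewrite divr_ge0/=; [rewrite ler_wpM2r ?invr_ge0; lra|lra|lra].
  have := congr1 (fun g : {ffun 'I_d -> 'I_(ncell z)} => g k : nat) fuv.
  have /andP[u0 u1] := b _ uS; have /andP[v0 v1] := b _ vS.
  rewrite !ffunE !inordK ?ltnS ?le_truncn// => e.
  have /andP[u2 u3] := truncn_itv u0; have /andP[v2 v3] := truncn_itv v0.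
  move: u2 u3 v2 v3; rewrite e -natr1; set m := _%:R.
  rewrite ler_pdivlMr// ltr_pdivrMr// ler_pdivlMr// ltr_pdivrMr// => *.
  by rewrite ltr_norml; lra.
rewrite -(size_map f); apply: leq_trans (uniq_leq_size fu (s2 := enum predT) _) _.
  by move=> ? _; rewrite mem_enum.
by rewrite -cardE card_ffun !card_ord.
Qed.

Lemma packing_number_ge S z l : 0 < z -> in_cube S -> is_packing S z l ->
  (size l <= packing_number S z)%N.
Proof.
move=> z0 Sc lS; have lt : (size l < (ncell z ^ d).+1)%N.
  by rewrite ltnS (packing_size z0 Sc lS).
have h : `[< exists2 l', is_packing S z l' & size l' = Ordinal lt >].
  by apply/asboolP; exists l.
by rewrite /packing_number (bigD1 (Ordinal lt)) //= leq_max leqnn.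
Qed.

Lemma packing_number_attained S z :
  exists2 l, is_packing S z l & size l = packing_number S z.
Proof.
have h : `[< exists2 l, is_packing S z l & size l = @ord0 (ncell z ^ d) >].
  by apply/asboolP; exists [::].
rewrite /packing_number (bigop.bigmax_eq_arg ord0 h).
by case: arg_maxnP => // i /asboolP.
Qed.

Lemma packing_number_le S z : (packing_number S z <= ncell z ^ d)%N.
Proof. by apply/bigmax_leqP => i _; rewrite -ltnS. Qed.

Lemma packing_number_upper S z : 0 < z <= 1 ->
  (packing_number S z)%:R <= (3 / z) ^+ d.
Proof.
move=> /andP[z0 z1]; apply: (@le_trans _ _ ((ncell z ^ d)%:R)).
  by rewrite ler_nat packing_number_le.
have z3 : 0 <= 3 / z by rewrite divr_ge0// ltW.
rewrite natrX lerXn2r ?nnegrE ?ler0n//.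
rewrite /ncell -natr1; have : (Num.truncn (2 / z))%:R <= 2 / z.
  by rewrite truncn_le divr_ge0 ?ltW.
have : 1 <= z^-1 by rewrite invf_ge1.
by lra.
Qed.

Lemma packing_number_gt0 S z v : 0 < z -> in_cube S -> S v ->
  (0 < packing_number S z)%N.
Proof.
move=> z0 Sc Sv; apply: (@packing_number_ge S z [:: v]) => //.
by rewrite /is_packing /= Sv.
Qed.

Lemma packing_number_sub S S' z : 0 < z -> in_cube S' -> {subset S <= S'} ->
  (packing_number S z <= packing_number S' z)%N.
Proof.
move=> z0 Sc sub; have [l /andP[lS lz] <-] := packing_number_attained S z.
by apply: packing_number_ge => //; rewrite /is_packing lz (sub_all sub lS).
Qed.

(** Packings of the two parts can be concatenated. Separation at the coarser radius [z'] suffices,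
    so one gap serves all radii of the potential. *)
Lemma packing_numberD S1 S2 S z (z' : R) : 0 < z <= z' -> in_cube S ->
    {subset S1 <= S} -> {subset S2 <= S} ->
    {in S1 & S2, forall u v, sep z' u v} ->
  (packing_number S1 z + packing_number S2 z <= packing_number S z)%N.
Proof.
move=> /andP[z0 zz] Sc s1 s2 s12.
have [l1 /andP[l1S l1z] <-] := packing_number_attained S1 z.
have [l2 /andP[l2S l2z] <-] := packing_number_attained S2 z.
rewrite -size_cat; apply: packing_number_ge => //.
rewrite /is_packing all_cat (sub_all s1 l1S) (sub_all s2 l2S) pairwise_cat.
rewrite l1z l2z !andbT /=; apply/allrelP => u v /(allP l1S) uS /(allP l2S) vS.
have /existsP[k h] := s12 u v uS vS.
by apply/existsP; exists k; apply: le_trans zz h.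
Qed.

Lemma packing_number_contract S S' z (r : R) y : 0 < z -> 0 < r -> in_cube S' ->
    {in S, forall v, S' (y + r *: (v - y))} ->
  (packing_number S z <= packing_number S' (z * r))%N.
Proof.
move=> z0 r0 Sc h; have [l /andP[lS lz] <-] := packing_number_attained S z.
rewrite -(size_map (fun v => y + r *: (v - y))).
apply: packing_number_ge => //; first exact: mulr_gt0.
rewrite /is_packing all_map pairwise_map; apply/andP; split.
  by apply: sub_all lS => v; apply: h.
apply: sub_pairwise lz => u v /existsP[k e]; apply/existsP; exists k.
rewrite !mxE (_ : _ - _ = r * (u 0 k - v 0 k)); last by ring.
by rewrite normrM gtr0_norm// mulrC ler_pM2l.
Qed.

(** * The potential as a weighted sum of packing numbers *)

Definition contraction_gap : R := (4 * d.+1%:R)^-1.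
Local Notation lam := contraction_gap.
Definition contraction_ratio : R := 1 - lam.
Local Notation rho := contraction_ratio.

Lemma contraction_gap_itv : 0 < lam <= 1 / 4.
Proof.
have d0 : 1 <= d.+1%:R :> R by rewrite ler1n.
rewrite /lam invr_gt0 mulr_gt0//=.
by rewrite invfM div1r ler_piMr ?invr_ge0 ?invf_le1.
Qed.

Lemma contraction_ratio_itv : 3 / 4 <= rho < 1.
Proof. by have := contraction_gap_itv; rewrite /rho; lra. Qed.

Lemma contraction_ratio_gt0 : 0 < rho.
Proof. by have := contraction_ratio_itv; lra. Qed.

(** The gap [1 / (4 * d.+1)] is chosen so that Bernoulli's inequality loses only 1/4 over [d.+1]
    factors. *)
Lemma contraction_ratio_expr_ge : 3 / 4 <= rho ^+ d.+1.
Proof.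
have l := contraction_gap_itv.
apply: le_trans (bernoulli_ineq d.+1 (_ : 0 <= lam <= 1)); last by lra.
rewrite /lam invfM mulrCA divff ?pnatr_eq0// mulr1; lra.
Qed.

Lemma scaled_gt0 z j : 0 < z -> 0 < z * rho ^+ j.
Proof. by move=> z0; rewrite mulr_gt0// exprn_gt0// contraction_ratio_gt0. Qed.

Lemma scaled_le z j : 0 <= z -> z * rho ^+ j <= z.
Proof.
move=> z0; rewrite ler_piMr// exprn_ile1//; have := contraction_ratio_itv; lra.
Qed.

Definition pot_term z S (j : nat) : R :=
  (packing_number S (z * rho ^+ j))%:R * rho ^+ (j * d.+1).

Definition potential z (J : nat) S : R := \sum_(j < J.+1) pot_term z S j.

Lemma pot_term_ge0 z S j : 0 <= pot_term z S j.
Proof. by rewrite mulr_ge0// exprn_ge0// ltW// contraction_ratio_gt0. Qed.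

(** Packing numbers grow at most like [rho ^- (j * d)], so the weight leaves one spare factor
    [rho ^+ j]. The terms are thus dominated by a geometric series, with a sum bounded uniformly in
    [J]. *)
Lemma pot_term_le S z j : 0 < z <= 1 ->
  pot_term z S j <= (3 / z) ^+ d * rho ^+ j.
Proof.
move=> /andP[z0 z1]; have r0 := exprn_gt0 j contraction_ratio_gt0.
have e : rho ^+ (j * d.+1) = (rho ^+ j) ^+ d * rho ^+ j.
  by rewrite exprM exprSr.
rewrite /pot_term e mulrA ler_pM2r//.
have h : 0 < z * rho ^+ j <= 1.
  by rewrite scaled_gt0//=; apply: le_trans (scaled_le _ (ltW z0)) z1.
apply: le_trans (ler_wpM2r (exprn_ge0 _ (ltW r0)) (packing_number_upper S h)) _.
by rewrite -exprMn invfM mulrA -!mulrA mulVf ?mulr1 ?gt_eqF.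
Qed.

Lemma potential_le z J S : 0 < z <= 1 ->
  potential z J S <= (3 / z) ^+ d * (4 * d.+1%:R).
Proof.
move=> zi; have /andP[z0 _] := zi.
apply: (@le_trans _ _ (\sum_(j < J.+1) (3 / z) ^+ d * rho ^+ j)).
  by apply: ler_sum => j _; apply: pot_term_le.
rewrite -mulr_sumr ler_wpM2l//; first by rewrite exprn_ge0// divr_ge0// ltW.
have l := contraction_gap_itv.
have -> : 4 * d.+1%:R = lam^-1 :> R by rewrite invrK.
rewrite -[lam^-1]mulr1 ler_pdivlMl; last by lra.
have -> : lam = 1 - rho by rewrite /rho; ring.
rewrite -[1 - rho]opprB mulNr -subrX1 opprB lerBlDr lerDl.
by rewrite exprn_ge0// ltW// contraction_ratio_gt0.
Qed.

Lemma potential_ge1 z J S v : 0 < z -> in_cube S -> S v -> 1 <= potential z J S.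
Proof.
move=> z0 Sc Sv; rewrite /potential big_ord_recl ler_wpDr//.
  by apply: sumr_ge0 => j _; apply: pot_term_ge0.
rewrite /pot_term /= mul0n !expr0 !mulr1 ler1n.
exact: packing_number_gt0 Sv.
Qed.

Lemma potential_sub z J S S' : 0 < z -> in_cube S' -> {subset S <= S'} ->
  potential z J S <= potential z J S'.
Proof.
move=> z0 Sc sub; apply: ler_sum => j _.
rewrite ler_wpM2r ?exprn_ge0 ?(ltW contraction_ratio_gt0)// ler_nat.
exact: packing_number_sub (scaled_gt0 _ z0) Sc sub.
Qed.

Lemma potential_empty z J S : (forall v, ~~ S v) -> potential z J S = 0.
Proof.
move=> S0; apply: big1 => j _; rewrite /pot_term.
have [[|v l] /andP[/= lS _] <-] := packing_number_attained S (z * rho ^+ j).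
  by rewrite mul0r.
by move: lS; rewrite (negbTE (S0 v)).
Qed.

Lemma potentialD z J S1 S2 S : 0 < z -> in_cube S ->
    {subset S1 <= S} -> {subset S2 <= S} ->
    {in S1 & S2, forall u v, sep z u v} ->
  potential z J S1 + potential z J S2 <= potential z J S.
Proof.
move=> z0 Sc s1 s2 s12; rewrite -big_split; apply: ler_sum => j _ /=.
rewrite -mulrDl -natrD ler_wpM2r ?exprn_ge0 ?(ltW contraction_ratio_gt0)// ler_nat.
apply: (packing_numberD (z' := z)) => //.
by rewrite scaled_gt0//= scaled_le// ltW.
Qed.

(* The weights [rho ^+ (j * d.+1)] turn the shift [j -> j.+1] caused by
   rescaling into a factor [rho ^+ d.+1], so that [potential] behaves like a
   volume under homotheties, up to the truncation of the series at [J]. *)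
Lemma potential_contract z J S S' y : 0 < z <= 1 ->
    (3 / z) ^+ d * rho ^+ J <= 1 / 12 -> in_cube S' ->
    {in S, forall v, S' (y + rho *: (v - y))} ->
  3 / 4 * (potential z J S - 1 / 12) <= potential z J S'.
Proof.
move=> zi tail Sc h; have /andP[z0 _] := zi.
have e1 : potential z J S - 1 / 12 <= \sum_(j < J) pot_term z S j.
  rewrite /potential big_ord_recr /= -addrA gerDl subr_le0.
  exact: le_trans (pot_term_le S J zi) tail.
have s0 : 0 <= \sum_(j < J) pot_term z S j.
  by apply: sumr_ge0 => j _; apply: pot_term_ge0.
apply: le_trans (_ : rho ^+ d.+1 * \sum_(j < J) pot_term z S j <= _).
  apply: le_trans (ler_wpM2r s0 contraction_ratio_expr_ge).
  by rewrite ler_pM2l//; lra.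
rewrite /potential big_ord_recl ler_wpDl ?pot_term_ge0// mulr_sumr.
apply: ler_sum => j _; rewrite /pot_term mulrCA -exprD -mulSn /=.
rewrite ler_wpM2r ?exprn_ge0 ?(ltW contraction_ratio_gt0)// ler_nat.
rewrite [X in (_ <= packing_number _ (_ * X))%N]exprSr mulrA.
apply: packing_number_contract h => //; first exact: scaled_gt0.
exact: contraction_ratio_gt0.
Qed.

(** * Balanced cuts by hyperplanes *)

Definition half_le S x (p : R) : pred V := [pred v | S v && (dotp v x <= p)].
Definition half_ge S x (p : R) : pred V := [pred v | S v && (p <= dotp v x)].

Lemma half_le_sub S x p : {subset half_le S x p <= S}.
Proof. by move=> v /andP[]. Qed.

Lemma half_ge_sub S x p : {subset half_ge S x p <= S}.
Proof. by move=> v /andP[]. Qed.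

Lemma in_cube_sub S S' : {subset S <= S'} -> in_cube S' -> in_cube S.
Proof. by move=> s c v /s/c. Qed.

Definition convex_pred S :=
  forall u v (r : R), S u -> S v -> 0 <= r <= 1 -> S (u + r *: (v - u)).

(** If all coordinates differ by less than [z], the values differ by at most [d * z]; the factor
    [d.+1] makes this strict, also for [d = 0]. *)
Lemma gap_sep z u v x : 0 < z -> inBall x ->
  d.+1%:R * z <= dotp v x - dotp u x -> sep z u v.
Proof.
move=> z0 xB; apply: contraTT => /existsPn h; rewrite -ltNge.
rewrite -dotpBl; apply: le_lt_trans (ler_norm _) _.
apply: le_lt_trans (ler_norm_dotp (c := z) xB _) _.
  by move=> k; have := h k; rewrite -ltNge !mxE distrC => /ltW.
by rewrite ltr_pM2r// ltr_nat.
Qed.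

(** Sweep a threshold in steps [g = d.+1 * z] until the lower part first exceeds half the potential.
    One [g] of the gap pays for the last step, the other separates the two parts so that
    superadditivity applies. *)
Lemma balanced_gap z J S x v : 0 < z -> in_cube S -> inBall x -> S v ->
  exists p, potential z J (half_le S x p) <= potential z J S / 2 /\
    potential z J (half_ge S x (p + 2 * (d.+1%:R * z))) <= potential z J S / 2.
Proof.
move=> z0 Sc xB Sv; set M := potential z J S.
have M1 : 1 <= M by apply: potential_ge1 Sv.
have dv u : S u -> `|dotp u x| <= d%:R.
  by move=> Su; rewrite -[d%:R]mulr1; apply: ler_norm_dotp => // k; apply: Sc.
set g := d.+1%:R * z; have g0 : 0 < g by rewrite mulr_gt0.
(* All values lie in [[- d, d]], so the sweep starts with an empty lower part. *)
pose p k : R := - d.+1%:R + k%:R * g.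
have ex : exists k, M / 2 < potential z J (half_le S x (p k)).
  exists (Num.bound (2 * d.+1%:R / g)).
  apply: lt_le_trans (_ : M <= _); first by lra.
  apply: potential_sub => // [|u Su]; first exact: in_cube_sub (@half_le_sub _ _ _) Sc.
  apply/andP; split; first exact: Su.
  have : 2 * d.+1%:R < (Num.bound (2 * d.+1%:R / g))%:R * g.
    rewrite -ltr_pdivrMr//; apply: archi_boundP.
    by rewrite !mulr_ge0 ?invr_ge0 ?(ltW g0).
  have := dv u Su; rewrite /p -natr1 ler_norml => /andP[_].
  by set a := d%:R; set b := _%:R; lra.
case: (ex_minnP ex) => -[|k] hk mk.
  exfalso; move: hk; rewrite potential_empty; first by lra.
  move=> u; apply/negP => /andP[/= /dv]; rewrite /p mul0r addr0 -natr1 ler_norml.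
  by move=> /andP[]; lra.
exists (p k); split; first by rewrite leNgt; apply/negP => /mk; rewrite ltnn.
have -> : p k + 2 * g = p k.+1 + g by rewrite /p -natr1; ring.
have sp : {in half_le S x (p k.+1) & half_ge S x (p k.+1 + g),
    forall a b, sep z a b}.
  move=> a b /andP[_ /= a1] /andP[_ /= b1]; apply: gap_sep z0 xB _.
  by rewrite -/g; lra.
have := potentialD J z0 Sc (@half_le_sub _ _ _) (@half_ge_sub _ _ _) sp.
by rewrite -/M; lra.
Qed.

(* Let [p1] and [p2] be the two ends of the gap. The contraction towards [yl]
   maps the part below [p2] into the part below [p1] if [p2] is far from [yl];
   otherwise [p1] is far from [yu], and one contracts towards [yu]. *)
Lemma good_cut z J S x yl yu : 0 < z <= 1 ->
    (3 / z) ^+ d * rho ^+ J <= 1 / 12 ->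
    in_cube S -> convex_pred S -> inBall x -> S yl -> S yu ->
    16 * d.+1%:R ^+ 2 * z <= dotp yu x - dotp yl x ->
  exists p, potential z J (half_le S x p) <= 3 / 4 * potential z J S /\
            potential z J (half_ge S x p) <= 3 / 4 * potential z J S.
Proof.
move=> zi tail Sc Sx xB Sl Su w; have /andP[z0 _] := zi.
have [p1 []] := balanced_gap J z0 Sc xB Sl.
set g := d.+1%:R * z; set p2 := p1 + _; set M := potential z J S => h1 h2.
have M1 : 1 <= M by apply: potential_ge1 Sl.
have g0 : 0 < g by rewrite mulr_gt0.
have r1 : 0 <= rho <= 1 by have := contraction_ratio_itv; lra.
(* A value at distance [8 * d.+1 ^+ 2 * z] from the centre is moved by exactly the length [2 * g] of
   the gap. The assumed spread is twice this distance, so one end of the gap is far enough from [yl]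
   or [yu]. *)
have lg : lam * (8 * d.+1%:R ^+ 2 * z) = 2 * g.
  have D0 : d.+1%:R != 0 :> R by rewrite pnatr_eq0.
  by rewrite /lam /g; move: d.+1%:R D0 => D D0; field.
have l0 : 0 < lam by have /andP[] := contraction_gap_itv.
have dT u y : dotp (y + rho *: (u - y)) x =
    dotp u x - lam * (dotp u x - dotp y x).
  by rewrite dotpDl dotpZl dotpBl /rho; ring.
have leC p : in_cube (half_le S x p) by apply: in_cube_sub Sc; apply: half_le_sub.
have geC p : in_cube (half_ge S x p) by apply: in_cube_sub Sc; apply: half_ge_sub.
have [c|c] := leP (8 * d.+1%:R ^+ 2 * z) (p2 - dotp yl x).
  exists p2; split; last by lra.
  (* From [3/4 * (P - 1/12) <= M / 2] follows [P <= 2/3 * M + 1/12], which is at most [3/4 * M]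
     because [1 <= M]; hence the tail bound 1/12. *)
  have := @potential_contract z J (half_le S x p2) (half_le S x p1) yl zi tail (leC _).
  suff T : {in half_le S x p2, forall u, half_le S x p1 (yl + rho *: (u - yl))}.
    by move=> /(_ T); lra.
  move=> u /andP[Suu /= up]; apply/andP; split; first exact: Sx.
  rewrite dT.
  have := ler_wpM2l (ltW l0) c.
  have : 0 <= rho * (p2 - dotp u x) by rewrite mulr_ge0; lra.
  by rewrite lg /rho /p2; lra.
have c' : 8 * d.+1%:R ^+ 2 * z <= dotp yu x - p1 by rewrite /p2 in c; lra.
exists p1; split; first by lra.
have := @potential_contract z J (half_ge S x p1) (half_ge S x p2) yu zi tail (geC _).
suff T : {in half_ge S x p1, forall u, half_ge S x p2 (yu + rho *: (u - yu))}.
  by move=> /(_ T); lra.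
move=> u /andP[Suu /= up]; apply/andP; split; first exact: Sx.
rewrite dT.
have := ler_wpM2l (ltW l0) c'.
have : 0 <= rho * (dotp u x - p1) by rewrite mulr_ge0; lra.
by rewrite lg /rho /p2; lra.
Qed.

End Packing.

(** * Potentials at dyadic scales *)

Section Scales.
Variables (R : realType) (d : nat).
Local Notation V := 'rV[R]_d.
Implicit Types (S : pred V) (u v x : V) (i : nat).

(** Chosen so that the spread required by [good_cut] is exactly [2 ^- i]. *)
Definition scale_radius i : R := (2 ^+ i)^-1 / (16 * d.+1%:R ^+ 2).

Lemma inv_exp2_itv i : 0 < ((2 ^+ i)^-1 : R) <= 1.
Proof. by rewrite invr_gt0 exprn_gt0//= invf_le1 ?exprn_gt0// exprn_ege1// ler1n. Qed.

Lemma sqr_dim_ge1 : 1 <= d.+1%:R ^+ 2 :> R.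
Proof. by rewrite exprn_ege1// ler1n. Qed.

Lemma scale_radius_itv i : 0 < scale_radius i <= 1.
Proof.
have D := sqr_dim_ge1; have E := inv_exp2_itv i.
have D0 : 0 < 16 * d.+1%:R ^+ 2 :> R by lra.
by rewrite /scale_radius ler_pdivrMr// divr_gt0//; lra.
Qed.

(** Makes [scale_tail] hold; a large depth is harmless because [potential_le] is uniform in it. *)
Definition scale_depth i : nat :=
  Num.bound (12 * (3 / scale_radius i) ^+ d / contraction_gap R d).

Lemma scale_tail i :
  (3 / scale_radius i) ^+ d * contraction_ratio R d ^+ scale_depth i <= 1 / 12.
Proof.
have /andP[z0 _] := scale_radius_itv i.
have /andP[l0 l1] := contraction_gap_itv R d.
rewrite /scale_depth; set A := _ ^+ d; set J := Num.bound _.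
have A0 : 0 <= A by rewrite exprn_ge0// divr_ge0// ltW.
have J1 : 12 * A < J%:R * contraction_gap R d.
  rewrite -ltr_pdivrMr//; apply: archi_boundP.
  by rewrite mulr_ge0 ?invr_ge0 ?(ltW l0)// mulr_ge0.
have lb : 0 <= contraction_gap R d <= 1 by lra.
have := expr_1subM_le1 J lb; rewrite -/(contraction_ratio R d) => h.
have r0 : 0 <= contraction_ratio R d ^+ J.
  by rewrite exprn_ge0// ltW// contraction_ratio_gt0.
have := ler_wpM2l r0 (ltW J1).
by move: r0 h; set r := _ ^+ J; lra.
Qed.

Definition scale_potential i S : R := potential (scale_radius i) (scale_depth i) S.

Lemma scale_potential_ge1 i S v : in_cube S -> S v -> 1 <= scale_potential i S.
Proof. by move=> Sc; apply: potential_ge1 => //; have /andP[] := scale_radius_itv i. Qed.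

Lemma scale_potential_sub i S S' : in_cube S' -> {subset S <= S'} ->
  scale_potential i S <= scale_potential i S'.
Proof. by move=> Sc; apply: potential_sub => //; have /andP[] := scale_radius_itv i. Qed.

Lemma ln_le_sub1 (a : R) : 0 < a -> ln a <= a - 1.
Proof.
by move=> a0; rewrite -{1}[a](subrKC 1); apply: le_ln1Dx; lra.
Qed.

Lemma ln_scale_potential_le i S v : in_cube S -> S v ->
  ln (scale_potential i S) <=
    i.+1%:R * (106 * (d%:R * ln (d%:R : R) + 1)).
Proof.
move=> Sc Sv; have pot1 := scale_potential_ge1 i Sc Sv.
have zi := scale_radius_itv i; have /andP[z0 _] := zi.
have D1 := sqr_dim_ge1.
have d1 : 1 <= d.+1%:R :> R by rewrite ler1n.
have E0 : 0 < 2 ^+ i :> R by rewrite exprn_gt0.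
have A0 : 0 < 48 * (d.+1%:R ^+ 2 * 2 ^+ i) :> R by rewrite !mulr_gt0//; lra.
have e : 3 / scale_radius i = 48 * (d.+1%:R ^+ 2 * 2 ^+ i).
  have : d.+1%:R != 0 :> R by rewrite pnatr_eq0.
  have : 2 ^+ i != 0 :> R by rewrite gt_eqF.
  rewrite /scale_radius; move: (2 ^+ i) (d.+1%:R) => a b a0 b0.
  by field; apply/andP.
have D4 : 0 < 4 * d.+1%:R :> R by rewrite mulr_gt0.
apply: (@le_trans _ _ (ln ((3 / scale_radius i) ^+ d * (4 * d.+1%:R)))).
  rewrite ler_ln ?posrE; [exact: potential_le|lra|].
  by rewrite mulr_gt0// exprn_gt0// e.
rewrite lnM ?posrE ?exprn_gt0 ?e// lnXn// lnM ?posrE//; last first.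
  by rewrite mulr_gt0// exprn_gt0.
rewrite lnM ?posrE ?exprn_gt0// !lnXn//.
rewrite -[_ *+ d]mulr_natl -[ln _ *+ 2]mulr_natl -[ln 2 *+ i]mulr_natl.
have l48 : ln 48 <= 47 :> R by have := @ln_le_sub1 48 (ltr0n _ _); lra.
have l2 : ln 2 <= 1 :> R by have := @ln_le_sub1 2 (ltr0n _ _); lra.
have l2' : 1 / 2 <= ln 2 :> R.
  have /ln_le_sub1 : 0 < 2^-1 :> R by rewrite invr_gt0.
  by rewrite lnV ?posrE//; lra.
have l4 : ln (4 * d.+1%:R) <= 4 * d%:R + 3 :> R.
  by have := ln_le_sub1 D4; rewrite -natr1; lra.
have i0 := ler0n R i.
(* Here 51 is 47 + 4, from the bounds on [ln 48] and [ln (4 * d.+1)]. For [d >= 2],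
   [d <= 2 * d * ln d] and [ln d.+1 <= 2 * ln d] give 102 + 4 = 106. For [d <= 1] the term
   [d * ln d] vanishes and the [+ 1] takes over. *)
have key : 51 * d%:R + 2 * (d%:R * ln d.+1%:R) + 3 <=
    106 * (d%:R * ln (d%:R : R) + 1) :> R.
  have [d2|] := leqP 2 d; last first.
    case: (d) => [|[|//]] _; first by rewrite !mul0r !mulr0; lra.
    by rewrite ln1; lra.
  have d2' : 2 <= d%:R :> R by rewrite ler_nat.
  have a1 : 1 / 2 <= ln (d%:R : R).
    by apply: le_trans l2' _; rewrite ler_ln ?posrE//; lra.
  have a2 : ln d.+1%:R <= 2 * ln (d%:R : R).
    rewrite mulr_natl -lnXn; last by lra.
    rewrite ler_ln ?posrE ?exprn_gt0//; last by lra.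
    by rewrite -natr1; nra.
  have := ler_wpM2l (ler0n R d) a1; have := ler_wpM2l (ler0n R d) a2.
  by set a := d%:R; set b := ln a; set c := ln _; lra.
apply: le_trans (ler_wpM2l (ler0n R i.+1) key).
have L0 : 0 <= ln d.+1%:R :> R by rewrite ln_ge0.
have b1 : 0 <= d%:R * (1 - ln 2) * i%:R :> R by rewrite !mulr_ge0//; lra.
have b2 : 0 <= d%:R * (47 - ln 48) :> R by rewrite mulr_ge0//; lra.
have b3 : 0 <= d%:R * ln d.+1%:R * i%:R :> R by rewrite !mulr_ge0.
have b4 : 0 <= d%:R * i%:R :> R by rewrite mulr_ge0.
move: l4 b1 b2 b3 b4 i0; rewrite -(natr1 i).
move: (ln (4 * _)) (ln 2) (ln 48) (ln d.+1%:R) (d%:R) (i%:R) => *; lra.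
Qed.

(** The weight [2 ^- i] matches the width of the sets cut at scale [i], so that a cut pays for a
    loss proportional to that width. *)
Definition total_potential (I : nat) S : R :=
  \sum_(i < I) (2 ^+ i)^-1 * ln (scale_potential i S).

Lemma total_potential_ge0 I S v : in_cube S -> S v -> 0 <= total_potential I S.
Proof.
move=> Sc Sv; apply: sumr_ge0 => i _; rewrite mulr_ge0 ?ln_ge0//.
  by have /andP[/ltW] := inv_exp2_itv i.
exact: scale_potential_ge1 Sv.
Qed.

Lemma ln_scale_potential_sub i S S' v : in_cube S -> {subset S' <= S} -> S' v ->
  ln (scale_potential i S') <= ln (scale_potential i S).
Proof.
move=> Sc sub Sv; have Sc' := in_cube_sub sub Sc.
have h1 := scale_potential_ge1 i Sc' Sv.
have h2 := scale_potential_ge1 i Sc (sub _ Sv).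
by rewrite ler_ln ?posrE; [exact: scale_potential_sub|lra|lra].
Qed.

Lemma total_potential_drop I S S' v i : (i < I)%N ->
    in_cube S -> {subset S' <= S} -> S' v ->
    scale_potential i S' <= 3 / 4 * scale_potential i S ->
  (2 ^+ i)^-1 * ln (4 / 3) <= total_potential I S - total_potential I S'.
Proof.
move=> iI Sc sub Sv h.
have a' := scale_potential_ge1 i (in_cube_sub sub Sc) Sv.
have a := scale_potential_ge1 i Sc (sub _ Sv).
rewrite /total_potential (bigD1 (Ordinal iI))//= [X in _ <= _ - X](bigD1 (Ordinal iI))//=.
set s1 := \sum_(_ < _ | _) _; set s2 := \sum_(_ < _ | _) _.
have : s2 <= s1.
  apply: ler_sum => j _; rewrite ler_wpM2l//.
    by have /andP[/ltW] := inv_exp2_itv j.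
  exact: ln_scale_potential_sub Sv.
have : ln (scale_potential i S') + ln (4 / 3) <= ln (scale_potential i S).
  by rewrite -lnM ?posrE; [rewrite ler_ln ?posrE; lra|lra|lra].
have /andP[/ltW E _] := inv_exp2_itv i.
move=> /(ler_wpM2l E); lra.
Qed.

Lemma sum_succ_inv_exp2 (I : nat) :
  \sum_(i < I) (2 ^+ i)^-1 * i.+1%:R = 4 - (2 * I%:R + 4) * (2 ^+ I)^-1 :> R.
Proof.
elim: I => [|I IH]; first by rewrite big_ord0 expr0 invr1; ring.
by rewrite big_ord_recr /= IH exprS invfM -natr1; move: (2 ^- I) => a; field.
Qed.

(** The series of [i.+1 / 2 ^ i] sums to 4, whence 424 = 4 * 106. The bound is uniform in [I], which
    will depend on the instance. *)
Lemma total_potential_le I S v : in_cube S -> S v ->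
  total_potential I S <= 424 * (d%:R * ln (d%:R : R) + 1).
Proof.
move=> Sc Sv; set L := d%:R * _ + 1.
have L0 : 0 <= L.
  rewrite addr_ge0// mulr_ge0//; case: d => [|n]; first by rewrite ln0.
  by rewrite ln_ge0// ler1n.
apply: (@le_trans _ _ (\sum_(i < I) (2 ^+ i)^-1 * i.+1%:R * (106 * L))).
  apply: ler_sum => i _; rewrite -mulrA ler_wpM2l//.
    by have /andP[/ltW] := inv_exp2_itv i.
  exact: ln_scale_potential_le Sv.
rewrite -mulr_suml sum_succ_inv_exp2.
have : 0 <= (2 * I%:R + 4) * (2 ^+ I)^-1 :> R.
  by rewrite mulr_ge0 ?invr_ge0 ?exprn_ge0 ?addr_ge0 ?mulr_ge0.
by move=> /(mulr_ge0 L0); lra.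
Qed.

End Scales.

(** * The learner *)

Section Learner.
Variables (R : realType) (d : nat).
Local Notation V := 'rV[R]_d.
Implicit Types (S B : pred V) (s b v x : V).

(** Cauchy-Schwarz in the unit ball, from the nonnegative squared norms of [u - v] and [u + v]. *)
Lemma ler_norm_dotp_ball u v : inBall u -> inBall v -> `|dotp u v| <= 1.
Proof.
rewrite /inBall => uB vB.
have h (e : R) : e ^+ 2 = 1 -> e * dotp u v <= 1.
  move=> e1; have : 0 <= dotp (u - e *: v) (u - e *: v).
    by apply: sumr_ge0 => k _; rewrite -expr2 sqr_ge0.
  rewrite dotpBl dotpZl ![dotp _ (u - _)]dotpC !dotpBl !dotpZl [dotp v u]dotpC.
  rewrite mulrBr mulrA -expr2 e1; lra.
rewrite ler_norml; have := h 1 (expr1n _ _).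
have := h (-1) _; rewrite sqrrN expr1n => /(_ erefl).
by lra.
Qed.

Record knowledge S : Prop := Knowledge {
  knowledge_ball : forall v, S v -> inBall v;
  knowledge_convex : convex_pred S }.

Lemma knowledge_in_cube S : knowledge S -> in_cube S.
Proof. by case=> Sb _ v /Sb; apply: inBall_coord. Qed.

Definition hi S x : R := sup [set dotp v x | v in S].
Definition lo S x : R := inf [set dotp v x | v in S].
Definition width S x : R := hi S x - lo S x.

Lemma dotp_itv S x v : knowledge S -> inBall x -> S v -> -1 <= dotp v x <= 1.
Proof.
by move=> Sk xB Sv; rewrite -ler_norml ler_norm_dotp_ball//; apply: (knowledge_ball Sk).
Qed.

Lemma has_sup_dotp S x v : knowledge S -> inBall x -> S v ->
  has_sup [set dotp v x | v in S].
Proof.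
move=> Sk xB Sv; split; first by exists (dotp v x); exists v.
by exists 1 => _ [u Su <-]; have /andP[] := dotp_itv Sk xB Su.
Qed.

Lemma has_inf_dotp S x v : knowledge S -> inBall x -> S v ->
  has_inf [set dotp v x | v in S].
Proof.
move=> Sk xB Sv; split; first by exists (dotp v x); exists v.
by exists (-1) => _ [u Su <-]; have /andP[] := dotp_itv Sk xB Su.
Qed.

Lemma le_hi S x v : knowledge S -> inBall x -> S v -> dotp v x <= hi S x.
Proof.
move=> Sk xB Sv; apply: ub_le_sup; last by exists v.
by have [] := has_sup_dotp Sk xB Sv.
Qed.

Lemma ge_lo S x v : knowledge S -> inBall x -> S v -> lo S x <= dotp v x.
Proof.
move=> Sk xB Sv; apply: ge_inf; last by exists v.
by have [] := has_inf_dotp Sk xB Sv.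
Qed.

(** The extreme values need not be attained, as strict cuts leave non-closed sets; the strict
    inequality leaves room to approximate both. *)
Lemma width_witness S x v (w : R) : knowledge S -> inBall x -> S v ->
  w < width S x -> exists yl yu, [/\ S yl, S yu & w <= dotp yu x - dotp yl x].
Proof.
rewrite /width => Sk xB Sv ww.
have e0 : 0 < (hi S x - lo S x - w) / 2 by lra.
have [_ [yu Su <-] hu] := sup_adherent e0 (has_sup_dotp Sk xB Sv).
have [_ [yl Sl <-] hl] := inf_adherent e0 (has_inf_dotp Sk xB Sv).
by exists yl, yu; split=> //; rewrite -/(hi S x) -/(lo S x) in hu hl; lra.
Qed.

Lemma width_le2 S x v : knowledge S -> inBall x -> S v -> width S x <= 2.
Proof.
move=> Sk xB Sv.
have h1 : hi S x <= 1.
  apply: ge_sup; first by exists (dotp v x); exists v.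
  by move=> _ [u Su <-]; have /andP[] := dotp_itv Sk xB Su.
have h2 : -1 <= lo S x.
  apply: lb_le_inf; first by exists (dotp v x); exists v.
  by move=> _ [u Su <-]; have /andP[] := dotp_itv Sk xB Su.
by rewrite /width; lra.
Qed.

Definition dyadic_scale (w : R) : nat :=
  xget 0%N [set i | (2 ^+ i)^-1 < w <= 2 * (2 ^+ i)^-1].

Lemma dyadic_scaleP (w : R) : 0 < w <= 2 ->
  (2 ^+ dyadic_scale w)^-1 < w <= 2 * (2 ^+ dyadic_scale w)^-1.
Proof.
move=> /andP[w0 w2].
suff ex : exists i, (2 ^+ i)^-1 < w <= 2 * (2 ^+ i)^-1.
  exact: (@xgetPex _ 0%N [set i | (2 ^+ i)^-1 < w <= 2 * (2 ^+ i)^-1] ex).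
have ex : exists i, (2 ^+ i)^-1 < w.
  exists (Num.bound w^-1); rewrite -[w]invrK ltf_pV2 ?posrE ?invr_gt0 ?exprn_gt0//.
  by rewrite invrK; apply: upper_nthrootP.
case: (ex_minnP ex) => -[|k] hk mk; [exists 0%N|exists k.+1]; rewrite hk/=.
  by rewrite expr0 invr1 mulr1.
rewrite exprS invfM mulVKf ?pnatr_eq0// leNgt; apply/negP => /mk.
by rewrite ltnn.
Qed.

Lemma ln43_gt0 : 0 < ln (4 / 3) :> R.
Proof. by apply: ln_gt0; lra. Qed.

(** Any balanced threshold at the scale of the current width, picked by choice, with default [0] if
    there is none. *)
Definition balanced_cut S x : R :=
  let i := dyadic_scale (width S x) in
  xget 0 [set p |
    scale_potential i (half_le S x p) <= 3 / 4 * scale_potential i S /\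
    scale_potential i (half_ge S x p) <= 3 / 4 * scale_potential i S].

Lemma balanced_cutP S x v : knowledge S -> inBall x -> S v -> 0 < width S x ->
  let i := dyadic_scale (width S x) in let p := balanced_cut S x in
  scale_potential i (half_le S x p) <= 3 / 4 * scale_potential i S /\
  scale_potential i (half_ge S x p) <= 3 / 4 * scale_potential i S.
Proof.
move=> Sk xB Sv w0 i p.
have /andP[w1 _] : (2 ^+ i)^-1 < width S x <= 2 * (2 ^+ i)^-1.
  by apply: dyadic_scaleP; rewrite w0 (width_le2 Sk xB Sv).
have [yl [yu [Sl Su h]]] := width_witness Sk xB Sv w1.
apply: (@xgetPex _ 0 [set p |
    scale_potential i (half_le S x p) <= 3 / 4 * scale_potential i S /\
    scale_potential i (half_ge S x p) <= 3 / 4 * scale_potential i S]).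
apply: (good_cut (scale_radius_itv _ _ _) (scale_tail _ _ _)
  (knowledge_in_cube Sk) (knowledge_convex Sk) xB Sl Su).
apply: le_trans h; rewrite /scale_radius mulrC divfK//.
by rewrite mulf_neq0 ?expf_neq0 ?pnatr_eq0.
Qed.

(** A threshold outside the range would leave all of [S] on one side, where the potential could not
    drop. The posted price thus stays within the range that bounds the losses. *)
Lemma balanced_cut_itv S x v : knowledge S -> inBall x -> S v -> 0 < width S x ->
  lo S x <= balanced_cut S x <= hi S x.
Proof.
move=> Sk xB Sv w0; have [] := balanced_cutP Sk xB Sv w0.
set i := dyadic_scale _; set p := balanced_cut S x => h1 h2.
have Sc := knowledge_in_cube Sk; have pot1 := scale_potential_ge1 i Sc Sv.
have proper S' : {subset S' <= S} -> {subset S <= S'} ->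
    ~ scale_potential i S' <= 3 / 4 * scale_potential i S.
  by move=> s1 /(scale_potential_sub i (in_cube_sub s1 Sc)); lra.
apply/andP; split; rewrite leNgt; apply/negP => hp.
  apply: (proper _ (@half_ge_sub _ _ _ _ _) _ h2) => u Su; apply/andP; split=> //=.
  exact: le_trans (ltW hp) (ge_lo Sk xB Su).
apply: (proper _ (@half_le_sub _ _ _ _ _) _ h1) => u Su; apply/andP; split=> //=.
exact: le_trans (le_hi Sk xB Su) (ltW hp).
Qed.

Lemma balanced_cut_drop (I : nat) S S' x v : knowledge S -> inBall x ->
    0 < width S x -> (dyadic_scale (width S x) < I)%N -> S' v ->
    {subset S' <= half_le S x (balanced_cut S x)} \/
    {subset S' <= half_ge S x (balanced_cut S x)} ->
  width S x * ln (4 / 3) <= 2 * (total_potential I S - total_potential I S').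
Proof.
move=> Sk xB w0 sI Sv sub.
have sS : {subset S' <= S} by case: sub => h u /h /andP[].
have Sc := knowledge_in_cube Sk; have [h1 h2] := balanced_cutP Sk xB (sS _ Sv) w0.
have /andP[_ w2] : (2 ^+ dyadic_scale (width S x))^-1 < width S x <=
    2 * (2 ^+ dyadic_scale (width S x))^-1.
  by apply: dyadic_scaleP; rewrite w0 (width_le2 Sk xB (sS _ Sv)).
apply: le_trans (ler_wpM2r (ltW ln43_gt0) w2) _; rewrite -mulrA ler_pM2l//.
apply: (total_potential_drop sI Sc sS Sv).
case: sub => sub.
  apply: le_trans (scale_potential_sub _ _ sub) h1.
  exact: in_cube_sub (@half_le_sub _ _ _ _ _) Sc.
apply: le_trans (scale_potential_sub _ _ sub) h2.
exact: in_cube_sub (@half_ge_sub _ _ _ _ _) Sc.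
Qed.

(** Strict versions, since a refused price reveals a strict inequality. *)
Definition half_lt S x (p : R) : pred V := [pred v | S v && (dotp v x < p)].
Definition half_gt S x (p : R) : pred V := [pred v | S v && (p < dotp v x)].

Lemma knowledge_half S x (Q : pred R) : knowledge S ->
    (forall a e c : R, Q a -> Q c -> a <= e <= c -> Q e) ->
  knowledge [pred v | S v && Q (dotp v x)].
Proof.
move=> [Sb Sx] Qx; split=> [v /andP[/Sb]//|u v r /andP[Su Qu] /andP[Sv Qv] r01].
apply/andP; split; first exact: Sx.
rewrite /= in Qu Qv; rewrite dotpDl dotpZl dotpBl.
move: (dotp u x) (dotp v x) Qu Qv r01 => a c Qa Qc /andP[r0 r1].
by have [ac|ca] := leP a c; [apply: (Qx a _ c)|apply: (Qx c _ a)] => //; nra.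
Qed.

Lemma knowledge_half_le S x p : knowledge S -> knowledge (half_le S x p).
Proof.
by move=> Sk; apply: (knowledge_half x (Q := <= p) Sk) => a e c /=; lra.
Qed.

Lemma knowledge_half_ge S x p : knowledge S -> knowledge (half_ge S x p).
Proof.
by move=> Sk; apply: (knowledge_half x (Q := >= p) Sk) => a e c /=; lra.
Qed.

Lemma knowledge_half_lt S x p : knowledge S -> knowledge (half_lt S x p).
Proof.
by move=> Sk; apply: (knowledge_half x (Q := < p) Sk) => a e c /=; lra.
Qed.

Lemma knowledge_half_gt S x p : knowledge S -> knowledge (half_gt S x p).
Proof.
by move=> Sk; apply: (knowledge_half x (Q := > p) Sk) => a e c /=; lra.
Qed.

(** * The pricing rule and the loss in one round *)

Definition state := (pred V * pred V)%type.

(** The first case always trades at nonnegative profit; the second never trades, as no gain is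
    possible. In the other two, the side not being cut is sure to accept, so the single bit reveals
    the answer of the side being cut. *)
Definition post (st : state) x : R * R :=
  let: (K, L) := st in
  if hi K x <= lo L x then (hi K x, lo L x)
  else if hi L x < lo K x then (lo K x - 1, hi L x + 1)
  else if width L x <= width K x then (balanced_cut K x, lo L x)
  else (hi K x, balanced_cut L x).

Definition update (st : state) x (traded : bool) : state :=
  let: (K, L) := st in
  if hi K x <= lo L x then st
  else if hi L x < lo K x then st
  else if width L x <= width K x then
    (if traded then half_le K x (balanced_cut K x)
     else half_gt K x (balanced_cut K x), L)
  else
    (K, if traded then half_ge L x (balanced_cut L x)
        else half_lt L x (balanced_cut L x)).

Definition consistent (st : state) s b :=
  [/\ knowledge st.1, knowledge st.2, st.1 s & st.2 b].

Definition state_potential I (st : state) : R :=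
  total_potential I st.1 + total_potential I st.2.

Definition state_scale (st : state) x : nat :=
  maxn (dyadic_scale (width st.1 x)) (dyadic_scale (width st.2 x)).

Definition traded (pq : R * R) s b x : bool :=
  (dotp s x <= pq.1) && (pq.2 <= dotp b x).

(** The first two cases lose nothing. Otherwise the ranges are not ordered, so [hi B - lo S] and
    [hi S - lo B] are both at most the sum of the widths, hence at most twice the larger one. These
    differences bound both losses, and [balanced_cut_drop] converts the width into a drop. *)
Lemma post_update (I : nat) st s b x : consistent st s b -> inBall x ->
    (state_scale st x < I)%N ->
  let pq := post st x in
  let tr := traded pq s b x in
  let drop := state_potential I st - state_potential I (update st x tr) in
  [/\ consistent (update st x tr) s b,
      (Num.max (dotp b x - dotp s x) 0 - (dotp b x - dotp s x) * tr%:R) *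
        ln (4 / 3) <= 4 * drop &
      Num.max 0 (- ((pq.2 - pq.1) * tr%:R)) * ln (4 / 3) <= 4 * drop].
Proof.
case: st => S B [/= Sk Bk Ss Bb] xB; rewrite /state_scale gtn_max /= => /andP[sI bI].
have s1 := ge_lo Sk xB Ss; have s2 := le_hi Sk xB Ss.
have b1 := ge_lo Bk xB Bb; have b2 := le_hi Bk xB Bb.
have l0 := ltW ln43_gt0.
rewrite /traded /state_potential.
case: (leP (hi S x) (lo B x)) => [c1|c1] /=.
  rewrite (_ : dotp s x <= _) // (_ : _ <= dotp b x) //= subrr mulr0 !mulr1.
  split; [by []| |].
    by rewrite max_l ?subrr ?mul0r//; lra.
  by rewrite max_l ?mul0r//; lra.
case: (ltP (hi B x) (lo S x)) => [c2|c2] /=.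
  have -> : (dotp s x <= lo S x - 1) = false by apply/negbTE; rewrite -ltNge; lra.
  rewrite /= !mulr0 oppr0 addr0 subrr mulr0 maxxx mul0r; split=> //.
  by rewrite max_r ?mul0r//; lra.
case: (leP (width B x) (width S x)) => [c3|c3] /=.
  set p := balanced_cut S x; rewrite b1 andbT.
  set S' := if _ then _ else _.
  have S's : S' s.
    rewrite /S'; case: (leP (dotp s x) p) => h; apply/andP; split=> //.
  have sub : {subset S' <= half_le S x p} \/ {subset S' <= half_ge S x p}.
    rewrite /S'; case: (leP (dotp s x) p) => h; [by left|right] => u /andP[Su /= up].
    by apply/andP; rewrite ltW.
  have S'k : knowledge S'.
    rewrite /S'; case: (leP (dotp s x) p) => _; [exact: knowledge_half_le|exact: knowledge_half_gt].
  (* The widths sum to [(hi S - lo B) + (hi B - lo S)], which is positive after the two failed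
     tests, so the larger width is positive. *)
  have w0 : 0 < width S x by move: c3; rewrite /width; lra.
  have p_itv := balanced_cut_itv Sk xB Ss w0; rewrite -/p in p_itv.
  have := balanced_cut_drop Sk xB w0 sI S's sub; set D := _ - _ => hD.
  have -> : total_potential I S + total_potential I B -
      (total_potential I S' + total_potential I B) = D by rewrite /D; ring.
  have lw : 2 * width S x * ln (4 / 3) <= 4 * D by lra.
  split=> //; apply: le_trans lw; rewrite ler_wpM2r//; rewrite /width in c3 *.
    by case: (leP (dotp s x) p) => h1; case: (leP (dotp b x - dotp s x) 0) => h2;
      rewrite /= ?mulr1 ?mulr0; lra.
  by rewrite ge_max; case: (leP (dotp s x) p) => h1 /=; rewrite /= ?mulr1 ?mulr0 ?oppr0; lra.
set q := balanced_cut B x; rewrite s2 /=.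
set B' := if _ then _ else _.
have B'b : B' b.
  rewrite /B'; case: (leP q (dotp b x)) => h; apply/andP; split=> //.
have sub : {subset B' <= half_le B x q} \/ {subset B' <= half_ge B x q}.
  rewrite /B'; case: (leP q (dotp b x)) => h; [by right|left] => u /andP[Bu /= uq].
  by apply/andP; rewrite ltW.
have B'k : knowledge B'.
  rewrite /B'; case: (leP q (dotp b x)) => _; [exact: knowledge_half_ge|exact: knowledge_half_lt].
have w0 : 0 < width B x by move: c3; rewrite /width; lra.
have q_itv := balanced_cut_itv Bk xB Bb w0; rewrite -/q in q_itv.
have := balanced_cut_drop Bk xB w0 bI B'b sub; set D := _ - _ => hD.
have -> : total_potential I S + total_potential I B -
    (total_potential I S + total_potential I B') = D by rewrite /D; ring.
have lw : 2 * width B x * ln (4 / 3) <= 4 * D by lra.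
split=> //; apply: le_trans lw; rewrite ler_wpM2r//; rewrite /width in c3 *.
  by case: (leP q (dotp b x)) => h1; case: (leP (dotp b x - dotp s x) 0) => h2;
    rewrite /= ?mulr1 ?mulr0; lra.
by rewrite ge_max; case: (leP q (dotp b x)) => h1 /=; rewrite /= ?mulr1 ?mulr0 ?oppr0; lra.
Qed.

(** * The run of the learner and summation over the rounds *)

Definition ball : pred V := [pred v | dotp v v <= 1].

Lemma knowledge_ball_pred : knowledge ball.
Proof.
split=> // u v r uB vB /andP[r0 r1]; rewrite /= /ball /=.
have uv := ler_norm_dotp_ball uB vB; move: uv; rewrite ler_norml => /andP[_ uv].
have -> : dotp (u + r *: (v - u)) (u + r *: (v - u)) =
    (1 - r) ^+ 2 * dotp u u + 2 * r * (1 - r) * dotp u v + r ^+ 2 * dotp v v.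
  rewrite dotpDl dotpZl dotpBl ![dotp _ (u + _)]dotpC !dotpDl !dotpZl !dotpBl.
  by rewrite [dotp v u]dotpC; ring.
have h1 := ler_wpM2l (sqr_ge0 (1 - r)) (uB : dotp u u <= 1).
have h2 := ler_wpM2l (sqr_ge0 r) (vB : dotp v v <= 1).
have r2 : 0 <= 2 * r * (1 - r) by rewrite !mulr_ge0//; lra.
have := ler_wpM2l r2 uv; lra.
Qed.

(** There is one more context than feedback bits; [zip] drops the current context, which only serves
    to set the next prices. *)
Definition learner_state (xs : seq V) (h : seq bool) : state :=
  foldl (fun st xb => update st xb.1 xb.2) (ball, ball) (zip xs h).

Definition learner : policy R d :=
  fun xs h => post (learner_state xs h) (last 0 xs).

Section Run.
Variables (T : nat) (s b : V) (x : nat -> V).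
Hypothesis valid : valid_instance T s b x.

Definition state_at (t : nat) : state :=
  learner_state (ctx_prefix x t.+1) (history learner s b x t).

Lemma size_history (pol : policy R d) t : size (history pol s b x t) = t.
Proof. by elim: t => //= t IH; rewrite size_rcons IH. Qed.

Lemma pricesE t : prices learner s b x t = post (state_at t) (x t).
Proof. by rewrite /prices /learner /ctx_prefix mkseqS last_rcons -mkseqS. Qed.

Lemma zip_rconsl (A C : Type) (a : seq A) (y : A) (c : seq C) :
  size a = size c -> zip (rcons a y) c = zip a c.
Proof. by elim: a c => [|z a IH] [|w c] //= [/IH ->]. Qed.

Lemma state_atS t :
  state_at t.+1 = update (state_at t) (x t) (traded (post (state_at t) (x t)) s b (x t)).
Proof.
rewrite /state_at /learner_state /ctx_prefix (mkseqS x t.+1) zip_rconsl; last first.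
  by rewrite size_mkseq size_history.
rewrite {1}mkseqS /= zip_rcons; last by rewrite size_mkseq size_history.
rewrite foldl_rcons /=; congr (update _ _ _).
  by rewrite mkseqS zip_rconsl// size_mkseq size_history.
by rewrite /traded -pricesE.
Qed.

Lemma state_at_consistent t : (t <= T)%N -> consistent (state_at t) s b.
Proof.
have [sB bB xB] := valid; elim: t => [_|t IH tT].
  by rewrite /state_at /learner_state /=; split=> //; apply: knowledge_ball_pred.
rewrite state_atS.
(* Consistency does not involve the number of scales, so any value above the current scale will
   do. *)
by have [] := post_update (IH (ltnW tT)) (xB _ tT) (ltnSn _).
Qed.

Lemma learner_bounds :
  det_regret learner T s b x <=
    3392 / ln (4 / 3) * (d%:R * ln (d%:R : R) + 1) /\
  neg_profit learner T s b x <=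
    3392 / ln (4 / 3) * (d%:R * ln (d%:R : R) + 1).
Proof.
have [sB bB xB] := valid.
(* Widths have no positive lower bound in advance, but the [T] rounds meet only finitely many
   scales. *)
pose I := (\max_(t < T) state_scale (state_at t) (x t)).+1.
have sI (t : 'I_T) : (state_scale (state_at t) (x t) < I)%N.
  by rewrite /I ltnS (bigD1 t)//= leq_maxl.
have l0 := ln43_gt0.
(* The sum telescopes; 3392 is 4 * 2 * 424, for the two sets of the initial state. *)
have tele : \sum_(t < T) 4 * (state_potential I (state_at t) -
      state_potential I (state_at t.+1)) <= 3392 * (d%:R * ln (d%:R : R) + 1).
  rewrite -mulr_sumr.
  have -> : \sum_(t < T) (state_potential I (state_at t) -
      state_potential I (state_at t.+1)) =
      state_potential I (state_at 0) - state_potential I (state_at T).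
    elim: (T) => [|n IH]; first by rewrite big_ord0 subrr.
    by rewrite big_ord_recr /= IH; ring.
  have [k1 k2 m1 m2] := state_at_consistent (leqnn T).
  have := total_potential_ge0 I (knowledge_in_cube k1) m1.
  have := total_potential_ge0 I (knowledge_in_cube k2) m2.
  have [k3 k4 m3 m4] := state_at_consistent (leq0n T).
  have := total_potential_le I (knowledge_in_cube k3) m3.
  have := total_potential_le I (knowledge_in_cube k4) m4.
  by rewrite /state_potential; lra.
have step (t : 'I_T) := post_update (state_at_consistent (ltnW (ltn_ord t)))
  (xB _ (ltn_ord t)) (sI t).
split; rewrite mulrAC ler_pdivlMr//; apply: le_trans tele; rewrite mulr_suml;
  apply: ler_sum => t _; have [_ h1 h2] := step t; rewrite state_atS.
  by apply: le_trans h1; rewrite /gft /trade pricesE.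
by apply: le_trans h2; rewrite /profit /trade pricesE.
Qed.

End Run.
End Learner.

Theorem theorem4p4 (R : realType) :
  exists C : R, forall d : nat, exists A : rand_alg R d,
    is_distribution A /\
    forall (T : nat) (s b : 'rV[R]_d) (x : nat -> 'rV[R]_d),
      valid_instance T s b x ->
      exp_regret A T s b x <= C * (d%:R * ln (d%:R : R) + 1) /\
      (forall wp, wp \in A ->
         neg_profit wp.2 T s b x <= C * (d%:R * ln (d%:R : R) + 1)).
Proof.
(* The distribution is the point mass at the deterministic learner, and the constant does not depend
   on [d]. *)
exists (3392 / ln (4 / 3)) => d; exists [:: (1, @learner R d)]; split.
  by split=> [wp|]; [rewrite inE => /eqP ->|rewrite big_seq1].
move=> T s b x valid; have [h1 h2] := learner_bounds valid; split.
  by rewrite /exp_regret big_seq1 mul1r.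
by move=> wp; rewrite inE => /eqP ->.
Qed.
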